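(* Let $a>0$ be a real number. Then $$\int_{0}^{\infty} \left[ e^{-x} - (1+x)^{-a} \right] \frac{dx}{x} = \psi(a).$$
   Context: $\psi$ denotes the digamma function, $\psi(x) = \frac{d}{dx}\log\Gamma(x) = \Gamma'(x)/\Gamma(x)$, where $\Gamma(x)=\int_0^\infty t^{x-1}e^{-t}\,dt$ for $x>0$. *)

(* Defs.v *)
From HB Require Import structures.
From mathcomp Require Import all_boot all_order all_algebra.
From mathcomp Require Import all_classical all_reals all_analysis.

Set Implicit Arguments.
Unset Strict Implicit.
Unset Printing Implicit Defensive.

Import Order.TTheory GRing.Theory Num.Theory.
Import numFieldNormedType.Exports.

Local Open Scope classical_set_scope.
Local Open Scope ring_scope.

(* Meaningful for 0 < x only: elsewhere the integral diverges and the
   real-valued [Rintegral] returns its default value. *)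
Definition Gamma (R : realType) (x : R) : R :=
  Rintegral (@lebesgue_measure R) `]0, +oo[ (fun t => t `^ (x - 1) * expR (- t)).

Definition digamma (R : realType) (x : R) : R :=
  derive1 (fun y : R => ln (Gamma y)) x.

(* Main.v *)
Require Import Defs.
From HB Require Import structures.
From mathcomp Require Import all_boot all_order all_algebra.
From mathcomp Require Import all_classical all_reals all_analysis.
From mathcomp Require Import measurable_realfun ring lra.

Set Implicit Arguments.
Unset Strict Implicit.
Unset Printing Implicit Defensive.

Import Order.TTheory GRing.Theory Num.Theory.
Import numFieldNormedType.Exports.

Local Open Scope classical_set_scope.
Local Open Scope ring_scope.

(** Two integral formulas meet in one double integral.  Differentiating
    Euler's integral under the integral sign gives
      Gamma'(a) = int_0^oo (ln t) t^(a-1) e^(-t) dt,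
    and Frullani's integral represents the logarithm as
      ln t = int_0^oo (e^(-s) - e^(-st)) / s ds.
    Substituting the second formula into the first and dividing by Gamma(a),
    digamma(a) becomes the iterated integral of
      Gamma(a)^-1 t^(a-1) e^(-t) (e^(-s) - e^(-st)) / s,
    first in s, then in t.  Integrating in t first gives the claim instead,
    because int_0^oo t^(a-1) e^(-(1+s)t) dt = (1+s)^(-a) Gamma(a).

    Fubini's theorem applies because, for fixed t, the Frullani integrand has
    the sign of ln t for every s: its absolute value integrates to |ln t|, so
    absolute convergence of the double integral is integrability of
    (ln t) t^(a-1) e^(-t) ([integrable_log_gamma_integrand]).  Frullani's
    integral itself ([integral_frullani]) is Tonelli's theorem for e^(-su) with
    s in ]0, oo[ and u between 1 and t.  Differentiation under the integral
    sign ([is_derive_Gamma]) needs a bound that is uniform for exponents near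
    a; it is a combination of two Euler integrands
    ([normr_log_gamma_integrand_le]). *)

(** * Primitives on segments and on the positive half-line *)

Section integration_tools.
Context {R : realType}.
Local Notation mu := (@lebesgue_measure R).
Implicit Types (f F : R -> R) (p q x M : R).

Lemma integral_itvcc_is_derive f F p q : p <= q ->
  (forall x, p <= x <= q -> {for x, continuous f}) ->
  (forall x, p <= x <= q -> is_derive x 1 F (f x)) ->
  (\int[mu]_(x in `[p, q]) (f x)%:E = (F q - F p)%:E)%E.
Proof.
rewrite le_eqVlt => /predU1P[-> _ _|pq cf dF].
  by rewrite set_itv1 integral_set1 subrr.
have cF x : p <= x <= q -> {for x, continuous F}.
  move=> xpq; have ? := dF x xpq.
  by apply: differentiable_continuous; apply/derivable1_diffP; exact: ex_derive.
rewrite (@continuous_FTC2 _ f F p q)//.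
- apply: continuous_in_subspaceT => x /set_mem /=.
  by rewrite in_itv/=; exact: cf.
- split.
  + move=> x; rewrite in_itv/= => /andP[px xq].
    by have [] : is_derive x 1 F (f x) by apply: dF; rewrite !ltW.
  + by apply: cvg_at_right_filter; apply: cF; rewrite lexx ltW.
  + by apply: cvg_at_left_filter; apply: cF; rewrite lexx ltW.
- move=> x; rewrite in_itv/= => /andP[px xq].
  rewrite derive1E.
  by have [] : is_derive x 1 F (f x) by apply: dF; rewrite !ltW.
Qed.

Lemma itv0y_bigcup :
  `]0, +oo[%classic = \bigcup_n `[n.+1%:R^-1, n.+1%:R]%classic :> set R.
Proof.
apply/seteqP; split => [x|x [n _]] /=; rewrite !in_itv/= ?andbT.
  move=> x0; pose m := maxn (Num.truncn x) (Num.truncn x^-1).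
  have xm (y : R) : (Num.truncn y <= m)%N -> y <= m.+1%:R.
    move=> ym; rewrite (le_trans (ltW (truncnS_gt _)))//.
    by rewrite ler_nat.
  exists m => //=; rewrite in_itv/= xm ?leq_maxl// andbT.
  by rewrite invf_ple ?posrE// xm// leq_maxr.
by move=> /andP[nx _]; rewrite (lt_le_trans _ nx)// invr_gt0.
Qed.

(** A convergence criterion for integrands that may be singular at both ends:
    over each [1/n, n] the integral is a difference of values of the bounded
    primitive [F], and these segments exhaust ]0, oo[. *)
Lemma ge0_integral_itv0y_le f F M :
  (forall x, 0 < x -> 0 <= f x) ->
  (forall x, 0 < x -> {for x, continuous f}) ->
  (forall x, 0 < x -> is_derive x 1 F (f x)) ->
  (forall x, 0 < x -> 0 <= F x <= M) ->
  (\int[mu]_(x in `]0%R, +oo[) (f x)%:E <= M%:E)%E.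
Proof.
move=> f0 cf dF FM.
have pos n x : n.+1%:R^-1 <= x -> 0 < x :> R.
  by apply: lt_le_trans; rewrite invr_gt0.
rewrite itv0y_bigcup.
pose D n : set R := `[n.+1%:R^-1, n.+1%:R]%classic.
have mD n : measurable (D n) by exact: measurable_itv.
have mf n : measurable_fun (D n) (EFin \o f).
  apply/measurable_EFinP; apply: subspace_continuous_measurable_fun.
    exact: mD.
  apply: continuous_in_subspaceT => x /set_mem.
  by rewrite /D/= in_itv/= => /andP[/pos + _]; exact: cf.
have fD0 : forall i x, D i x -> (0 <= (EFin \o f) x)%E.
  by move=> i x; rewrite /D/= in_itv/= => /andP[/pos x0 _]; rewrite lee_fin f0.
have ndD : nondecreasing_seq D.
  move=> m n mn; apply/subsetPset => x; rewrite /D/= !in_itv/= => /andP[mx xm].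
  rewrite (le_trans _ mx) ?(le_trans xm) ?ler_nat//.
  by rewrite lef_pV2 ?posrE// ler_nat.
have <- := cvg_lim _
  (ge0_nondecreasing_set_cvg_integral (mu := mu) ndD mD mf fD0) => //.
apply: lime_le.
  apply: ereal_nondecreasing_is_cvgn.
  exact: ge0_nondecreasing_set_nondecreasing_integral.
apply: nearW => n.
have n1 : (n.+1%:R^-1 : R) <= n.+1%:R.
  by rewrite (@le_trans _ _ 1) ?invf_le1 ?ler1n.
have -> : (\int[mu]_(x in D n) (EFin \o f) x = (F n.+1%:R - F n.+1%:R^-1)%:E)%E.
  by apply: integral_itvcc_is_derive => // x /andP[/pos x0 _];
    [exact: cf|exact: dF].
have /andP[F0 _] : 0 <= F n.+1%:R^-1 <= M by rewrite FM ?invr_gt0.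
have /andP[_ F1] : 0 <= F n.+1%:R <= M by rewrite FM.
by rewrite lee_fin; lra.
Qed.

End integration_tools.

(** * Exchanging integrals over a rectangle *)

(** The iterated integrals over [D1] and [D2] are those of the extension by
    zero of [f] outside [D1 `*` D2], to which the theorems on the whole product
    space apply. *)
Section fubini_on_rectangles.
Context d1 d2 (T1 : measurableType d1) (T2 : measurableType d2) (R : realType).
Variables (m1 : {sigma_finite_measure set T1 -> \bar R})
          (m2 : {sigma_finite_measure set T2 -> \bar R}).
Variables (D1 : set T1) (D2 : set T2).
Hypotheses (mD1 : measurable D1) (mD2 : measurable D2).
Variable f : T1 * T2 -> \bar R.
Hypothesis mf : measurable_fun (D1 `*` D2) f.

Local Notation fD := (f \_ (D1 `*` D2)).

Let mfD : measurable_fun setT fD.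
Proof. by apply/(measurable_restrictT f) => //; exact: measurableX. Qed.

Let int12 (g : \bar R -> \bar R) : g 0%E = 0%E ->
  (\int[m1]_(x in D1) \int[m2]_(y in D2) g (f (x, y)) =
   \int[m1]_x \int[m2]_y g (fD (x, y)))%E.
Proof.
move=> g0; rewrite integral_mkcond; apply: eq_integral => x _.
rewrite patchE; case: ifPn => xD1.
  rewrite integral_mkcond; apply: eq_integral => y _.
  by rewrite !patchE in_setX xD1 /=; case: ifPn.
rewrite integral0_eq// => y _.
by rewrite patchE in_setX (negbTE xD1).
Qed.

Let int21 (g : \bar R -> \bar R) : g 0%E = 0%E ->
  (\int[m2]_(y in D2) \int[m1]_(x in D1) g (f (x, y)) =
   \int[m2]_y \int[m1]_x g (fD (x, y)))%E.
Proof.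
move=> g0; rewrite integral_mkcond; apply: eq_integral => y _.
rewrite patchE; case: ifPn => yD2.
  rewrite integral_mkcond; apply: eq_integral => x _.
  by rewrite !patchE in_setX yD2 andbT /=; case: ifPn.
rewrite integral0_eq// => x _.
by rewrite patchE in_setX (negbTE yD2) andbF.
Qed.

Lemma tonelli_rect : (forall x y, D1 x -> D2 y -> (0 <= f (x, y))%E) ->
  (\int[m1]_(x in D1) \int[m2]_(y in D2) f (x, y) =
   \int[m2]_(y in D2) \int[m1]_(x in D1) f (x, y))%E.
Proof.
move=> f0; rewrite (int12 (g := id))// (int21 (g := id))//.
apply: fubini_tonelli => // -[x y].
by apply: erestrict_ge0 => -[? ?] [? ?]; exact: f0.
Qed.

Lemma fubini_rect :
  (\int[m1]_(x in D1) \int[m2]_(y in D2) `|f (x, y)| < +oo)%E ->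
  (\int[m1]_(x in D1) \int[m2]_(y in D2) f (x, y) =
   \int[m2]_(y in D2) \int[m1]_(x in D1) f (x, y))%E.
Proof.
rewrite (int12 (g := abse)) ?abse0// => fy.
rewrite (int12 (g := id))// (int21 (g := id))//.
by apply: Fubini; apply/integrable12ltyP.
Qed.

End fubini_on_rectangles.

(** * Dilations and Frullani's integral *)

Section elementary_integrals.
Context {R : realType}.
Local Notation mu := (@lebesgue_measure R).
Implicit Types (c p q s t u x : R).

(** By uniqueness of Lebesgue measure: the image of Lebesgue measure under
    x |-> c x, multiplied by c, gives every interval its length. *)
Lemma ge0_integral_itv0y_dilation c (f : R -> \bar R) : 0 < c ->
  measurable_fun (`]0, +oo[ : set R) f -> (forall x, 0 < x -> (0 <= f x)%E) ->
  (\int[mu]_(x in `]0%R, +oo[) f x =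
   c%:E * \int[mu]_(x in `]0%R, +oo[) f (c * x)%R)%E.
Proof.
move=> c0 mf f0; pose k : {nonneg R} := NngNum (ltW c0).
pose phi : measurableTypeR R -> measurableTypeR R := *%R c.
have mphi : measurable_fun setT phi.
  exact: mulrl_measurable.
rewrite (eq_measure_integral (mscale k (pushforward mu phi))); last first.
  move=> A mA _; apply: lebesgue_measure_unique => // _ [[p q]] _ <- /=.
  rewrite /mscale/= /pushforward.
  have -> : phi @^-1` [set` `]p, q]] = `](p / c), (q / c)]%classic.
    apply/seteqP; split=> x /=; rewrite !in_itv/= ltr_pdivrMr// ler_pdivlMr//;
    by rewrite ![x * c]mulrC.
  rewrite !lebesgue_measure_itv /= !lte_fin ltr_pM2r ?invr_gt0//.
  case: ifPn; rewrite ?mule0// => _.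
  by rewrite -!EFinB -EFinM mulrBr !(mulrCA c) divff ?gt_eqF// !mulr1.
rewrite ge0_integral_mscale//; last first.
  by move=> x; rewrite /= in_itv/= andbT; exact: f0.
rewrite ge0_integral_pushforward//; last first.
  by move=> x; rewrite inE/= in_itv/= andbT; exact: f0.
congr (_ * _)%E; congr (integral _ _ _).
by apply/seteqP; split=> x /=; rewrite !in_itv/= !andbT pmulr_rgt0.
Qed.

Lemma is_derive_primitive_expRN s x : s != 0 ->
  is_derive x 1 (fun u => - (s^-1 * expR (- (s * u)))) (expR (- (s * x))).
Proof.
move=> s0; apply: is_derive_eq.
rewrite -[_ *: (_ * _)]/(s^-1 * (expR (- (s * x)) * - (s * 1))).
by field.
Qed.

Lemma continuous_expRNM s : continuous (fun u => expR (- (s * u))).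
Proof.
move=> x; apply: differentiable_continuous; apply/derivable1_diffP.
exact: ex_derive.
Qed.

Lemma integral_expRN u : 0 < u ->
  (\int[mu]_(s in `]0%R, +oo[) (expR (- (u * s)))%:E = (u^-1)%:E)%E.
Proof.
move=> u0.
have cexp : continuous (fun s => expR (- (u * s))) by exact: continuous_expRNM.
have dF x : is_derive x 1 (fun s => - (u^-1 * expR (- (u * s))))
    (expR (- (u * x))).
  by apply: is_derive_primitive_expRN; rewrite gt_eqF.
rewrite integral_itv_obnd_cbnd; last first.
  apply/measurable_EFinP; apply: measurable_funTS.
  exact: continuous_measurable_fun.
rewrite (@ge0_continuous_FTC2y _ _ (fun s => - (u^-1 * expR (- (u * s)))) 0 0).
- by rewrite mulr0 oppr0 expR0 mulr1 EFinN sub0e oppeK.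
- by move=> x _; exact: expR_ge0.
- exact: continuous_subspaceT.
- rewrite -oppr0; apply: cvgN; rewrite -(mulr0 u^-1); apply: cvgMl_tmp.
  apply: (@cvg_comp _ _ _ _ (fun z => expR (- z)) _ (pinfty_nbhs R)).
    exact: gt0_cvgMry.
  exact: cvgr_expR.
- by move=> x _; have [] := dF x.
- apply: cvg_at_right_filter; apply: cvgN; apply: cvgMl_tmp; exact: cexp.
- by move=> x _; rewrite derive1E; have [] := dF x.
Qed.

Lemma integral_itvcc_expRN s p q : 0 < s -> p <= q ->
  (\int[mu]_(u in `[p, q]) (expR (- (s * u)))%:E =
   ((expR (- (s * p)) - expR (- (s * q))) / s)%:E)%E.
Proof.
move=> s0 pq.
pose F u := - (s^-1 * expR (- (s * u))).
rewrite [RHS](_ : _ = (F q - F p)%:E); last by congr EFin; rewrite /F; ring.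
apply: integral_itvcc_is_derive => // x _.
- exact: continuous_expRNM.
- by apply: is_derive_primitive_expRN; rewrite gt_eqF.
Qed.

Lemma integral_itvcc_inv p q : 0 < p -> p <= q ->
  (\int[mu]_(u in `[p, q]) (u^-1)%:E = (ln q - ln p)%:E)%E.
Proof.
move=> p0 pq; apply: integral_itvcc_is_derive => // x /andP[px _];
  have x0 := lt_le_trans p0 px.
- by apply: inv_continuous; rewrite gt_eqF.
- exact: is_derive1_ln.
Qed.

(** Both sides are the integral of e^(-su) over s > 0 and p <= u <= q, computed
    in the two orders. *)
Lemma frullani_expR p q : 0 < p -> p <= q ->
  (\int[mu]_(s in `]0%R, +oo[) ((expR (- (s * p)) - expR (- (s * q))) / s)%:E =
   (ln q - ln p)%:E)%E.
Proof.
move=> p0 pq.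
transitivity (\int[mu]_(s in `]0%R, +oo[) \int[mu]_(u in `[p, q])
    (expR (- (s * u)))%:E)%E.
  apply: eq_integral => s; rewrite inE/= in_itv/= andbT => s0.
  by rewrite integral_itvcc_expRN.
rewrite (@tonelli_rect _ _ _ _ _ mu mu _ _ _ _
  (fun z => (expR (- (z.1 * z.2)))%:E))//=.
- rewrite -integral_itvcc_inv//; apply: eq_integral => u.
  rewrite inE/= in_itv/= => /andP[pu _].
  under eq_integral do rewrite mulrC.
  by rewrite integral_expRN// (lt_le_trans p0).
- apply/measurable_EFinP; apply: measurable_funTS.
  apply: measurableT_comp => //; apply: measurableT_comp => //.
  exact: measurable_funM.
Qed.

Definition frullani_kernel t s : R := (expR (- s) - expR (- (s * t))) / s.

Let frullani_kernel_ge0 t s : 1 <= t -> 0 < s -> 0 <= frullani_kernel t s.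
Proof.
move=> t1 s0; rewrite divr_ge0 ?(ltW s0)// subr_ge0 ler_expR lerN2.
by rewrite ler_peMr ?(ltW s0).
Qed.

Let frullani_kernel_le0 t s : t <= 1 -> 0 < s -> frullani_kernel t s <= 0.
Proof.
move=> t1 s0; rewrite pmulr_lle0 ?invr_gt0// subr_le0 ler_expR lerN2.
by rewrite ler_piMr ?(ltW s0).
Qed.

Let integral_frullani_ge1 t : 1 <= t ->
  (\int[mu]_(s in `]0%R, +oo[) (frullani_kernel t s)%:E = (ln t)%:E)%E.
Proof.
move=> t1; have := frullani_expR ltr01 t1; rewrite ln1 subr0 => <-.
by apply: eq_integral => s _; rewrite mulr1.
Qed.

Let integral_frullani_le1 t : 0 < t -> t <= 1 ->
  (\int[mu]_(s in `]0%R, +oo[) (- frullani_kernel t s)%:E = (- ln t)%:E)%E.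
Proof.
move=> t0 t1; have := frullani_expR t0 t1; rewrite ln1 sub0r => <-.
by apply: eq_integral => s _; rewrite mulr1 /frullani_kernel -mulNr opprB.
Qed.

Lemma integral_frullani t : 0 < t ->
  (\int[mu]_(s in `]0%R, +oo[) (frullani_kernel t s)%:E = (ln t)%:E)%E.
Proof.
move=> t0; have [/integral_frullani_ge1//|/ltW t1] := leP 1 t.
under eq_integral do rewrite -[frullani_kernel _ _]opprK EFinN.
rewrite integral_ge0N ?integral_frullani_le1 -?EFinN ?opprK// => s /=.
by rewrite in_itv/= andbT lee_fin oppr_ge0 => s0; exact: frullani_kernel_le0.
Qed.

(** The kernel has the sign of [ln t] for every [s], so taking absolute values
    commutes with the integral. *)
Lemma integral_normr_frullani t : 0 < t ->
  (\int[mu]_(s in `]0%R, +oo[) `|(frullani_kernel t s)%:E| = `|ln t|%:E)%E.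
Proof.
move=> t0; have [t1|/ltW t1] := leP 1 t.
  rewrite ger0_norm ?ln_ge0// -integral_frullani_ge1//.
  apply: eq_integral => s; rewrite inE/= in_itv/= andbT => s0.
  by rewrite ger0_norm ?frullani_kernel_ge0.
rewrite ler0_norm ?ln_le0// -integral_frullani_le1//.
apply: eq_integral => s; rewrite inE/= in_itv/= andbT => s0.
by rewrite ler0_norm ?frullani_kernel_le0.
Qed.

(** The inverse is replaced by the power -1, which is the same function on
    ]0, oo[ and is measurable on the whole line. *)
Lemma measurable_frullani_kernel d (T : measurableType d) (D : set T)
    (f g : T -> R) : measurable_fun D f -> measurable_fun D g ->
  (forall z, D z -> 0 < g z) ->
  measurable_fun D (fun z => frullani_kernel (f z) (g z)).
Proof.
move=> mf mg g0.
apply: (eq_measurable_fun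
    (fun z => (expR (- g z) - expR (- (g z * f z))) * g z `^ (-1))).
  move=> z /set_mem Dz /=.
  by rewrite powR_inv1// ltW// g0.
apply: measurable_funM; last first.
  exact: (measurableT_comp (measurable_powR (-1))).
by apply: measurable_funB; apply: measurableT_comp => //;
  apply: measurableT_comp => //; exact: measurable_funM.
Qed.

Lemma integrable_frullani t : 0 < t ->
  mu.-integrable `]0, +oo[ (fun s => (frullani_kernel t s)%:E).
Proof.
move=> t0; apply/integrableP; split; last first.
  by rewrite integral_normr_frullani// ltry.
apply/measurable_EFinP; apply: measurable_frullani_kernel => //.
by move=> s /=; rewrite in_itv/= andbT.
Qed.

End elementary_integrals.

(** * Euler's integral *)

Section gamma_integral.
Context {R : realType}.
Local Notation mu := (@lebesgue_measure R).
Implicit Types (a c r s t x y : R).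

Definition gamma_integrand c t : R := t `^ (c - 1) * expR (- t).

Lemma gamma_integrand_ge0 c t : 0 <= gamma_integrand c t.
Proof. by rewrite mulr_ge0 ?powR_ge0 ?expR_ge0. Qed.

Lemma measurable_gamma_integrand c : measurable_fun setT (gamma_integrand c).
Proof.
apply: measurable_funM; first exact: measurable_powR.
by apply: measurableT_comp.
Qed.

Lemma powR_expR_ln t x : 0 < t -> t `^ x = expR (x * ln t).
Proof. by move=> t0; rewrite /powR gt_eqF. Qed.

(** The graph of [ln] lies below its tangent at [p]. *)
Lemma mulr_ln_le p y : 0 < p -> 0 < y -> p * ln y <= y - p + p * ln p.
Proof.
move=> p0 y0; have yp0 : 0 < y / p by rewrite divr_gt0.
have -> : ln y = ln (y / p) + ln p by rewrite -lnM ?posrE// divfK ?gt_eqF.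
rewrite mulrDr lerD2r.
have /(ler_wpM2l (ltW p0)) : ln (y / p) <= y / p - 1.
  have := @le_ln1Dx R (y / p - 1); rewrite (addrC 1) subrK; apply.
  by rewrite ltrDr.
by rewrite mulrBr mulr1 mulrCA divff ?mulr1 ?gt_eqF.
Qed.

(** The bounded function (t / (1 + t))^c increases on ]0, oo[ with derivative
    c t^(c-1) (1 + t)^(-c-1).  The latter has the behaviour of the integrand
    near 0, and dominates it up to a constant because (1 + t)^(c+1) is
    O(e^t). *)
Lemma integrable_gamma_integrand c : 0 < c ->
  mu.-integrable `]0, +oo[ (EFin \o gamma_integrand c).
Proof.
(* K bounds (1 + t)^p e^(-t), whose maximum is reached at 1 + t = p. *)
move=> c0; pose p := c + 1; pose K := expR (1 - p + p * ln p).
have p0 : 0 < p by rewrite addr_gt0.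
have t1_gt0 t : 0 < t -> 0 < 1 + t by move=> ?; rewrite addr_gt0.
pose F t := K / c * expR (c * (ln t - ln (1 + t))).
pose f t := K * (t^-1 * (1 + t)^-1 * expR (c * (ln t - ln (1 + t)))).
have dF t : 0 < t -> is_derive t 1 F (f t).
  move=> t0; have ? := is_derive1_ln t0; have t10 := t1_gt0 t t0.
  have ? : is_derive t 1 (fun x => ln (1 + x)) (1 + t)^-1.
    have ? := is_derive1_ln t10.
    by apply: is_derive_eq; rewrite add0r mulr1.
  rewrite /F; apply: is_derive_eq.
  rewrite -[LHS]/(K / c * (expR (c * (ln t - ln (1 + t))) *
    (c * (t^-1 - (1 + t)^-1)))) /f.
  by field; apply/and3P; split; rewrite gt_eqF.
have cf t : 0 < t -> {for t, continuous f}.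
  move=> t0; have t10 := t1_gt0 t t0.
  have c1 : {for t, continuous (fun x : R => 1 + x)}.
    by apply: continuousD => //; exact: cst_continuous.
  apply: continuousM; first exact: cst_continuous.
  apply: continuousM.
    apply: continuousM; first by apply: inv_continuous; rewrite gt_eqF.
    apply: (@continuous_comp _ _ _ (fun x : R => 1 + x) (@GRing.inv R)) => //.
    by apply: inv_continuous; rewrite gt_eqF.
  apply: (@continuous_comp _ _ _ _ expR); last exact: continuous_expR.
  apply: continuousM; first exact: cst_continuous.
  apply: continuousB; first exact: continuous_ln.
  apply: (@continuous_comp _ _ _ (fun x : R => 1 + x) (@ln R)) => //.
  exact: continuous_ln.
have gf t : 0 < t -> gamma_integrand c t <= f t.
  move=> t0; have t10 := t1_gt0 t t0.
  rewrite /gamma_integrand /f powR_expR_ln//.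
  rewrite -[in t^-1](lnK t0) -[in (1 + t)^-1](lnK t10).
  rewrite -!expRN /K -!expRD ler_expR.
  have := mulr_ln_le p0 t10; rewrite /p; nra.
apply/integrableP; split.
  apply/measurable_EFinP; apply: measurable_funTS.
  exact: measurable_gamma_integrand.
have f0 t : 0 < t -> 0 <= f t.
  by move=> t0; rewrite (le_trans _ (gf t t0))// gamma_integrand_ge0.
apply: (@le_lt_trans _ _ (K / c)%:E); last exact: ltry.
apply: (@le_trans _ _ (\int[mu]_(x in `]0%R, +oo[) (f x)%:E)%E); last first.
  apply: (@ge0_integral_itv0y_le _ f F) => // t t0.
  have t10 := t1_gt0 t t0.
  have K0 : 0 < K / c by rewrite divr_gt0 ?expR_gt0.
  rewrite /F mulr_ge0 ?expR_ge0 ?(ltW K0)//= ger_pMr// expR_le1.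
  by rewrite pmulr_rle0// subr_le0 ler_ln ?posrE ?lerDr.
apply: ge0_le_integral => //.
- apply/measurable_EFinP/measurableT_comp => //; apply: measurable_funTS.
  exact: measurable_gamma_integrand.
- apply/measurable_EFinP; apply: open_continuous_measurable_fun => //.
  by move=> t; rewrite inE/= in_itv/= andbT; exact: cf.
- move=> t /=; rewrite in_itv/= andbT => t0; rewrite lee_fin.
  by rewrite ger0_norm ?gamma_integrand_ge0// gf.
Qed.

Lemma Gamma_EFin c : 0 < c ->
  (\int[mu]_(t in `]0%R, +oo[) (gamma_integrand c t)%:E = (Gamma c)%:E)%E.
Proof.
move=> c0; rewrite /Gamma /Rintegral fineK//.
apply: integrable_fin_num => //; exact: integrable_gamma_integrand.
Qed.

Lemma Gamma_gt0 c : 0 < c -> 0 < Gamma c.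
Proof.
move=> c0; rewrite -lte_fin -Gamma_EFin//.
(* On [1, 2] both t^(c-1) >= t^(-1) >= 1/2 and e^(-t) >= e^(-2). *)
pose m : R := 2^-1 * expR (- 2).
have m0 : 0 < m by rewrite mulr_gt0 ?expR_gt0.
have sub12 : `[1%R, 2%R] `<=` (`]0%R, +oo[ : set R).
  move=> t /=; rewrite !in_itv/= andbT => /andP[t1 _].
  by rewrite (lt_le_trans ltr01).
have mg A : measurable_fun A (EFin \o gamma_integrand c).
  apply/measurable_EFinP; apply: measurable_funTS.
  exact: measurable_gamma_integrand.
apply: (@lt_le_trans _ _ (\int[mu]_(t in `[1%R, 2%R]) m%:E)%E).
  rewrite integral_cst//= lebesgue_measure_itv/= lte_fin ltr1n.
  by rewrite -EFinB -EFinM lte_fin mulr_gt0// subr_gt0 ltr1n.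
apply: (@le_trans _ _ (\int[mu]_(t in `[1%R, 2%R]) (gamma_integrand c t)%:E)%E).
  apply: ge0_le_integral => //.
  - by move=> t _; rewrite lee_fin ltW.
  - exact: mg.
  - move=> t /=; rewrite in_itv/= => /andP[t1 t2]; rewrite lee_fin.
    have t0 := lt_le_trans ltr01 t1.
    rewrite ler_pM ?invr_ge0 ?expR_ge0 ?ler_expR ?lerN2//.
    rewrite (@le_trans _ _ (t `^ (-1)))//; last first.
      by rewrite ler_powR// lerBrDr addNr ltW.
    by rewrite powR_inv1 ?(ltW t0)// lef_pV2 ?posrE.
apply: ge0_subset_integral => //; first exact: mg.
by move=> t _; rewrite lee_fin gamma_integrand_ge0.
Qed.

Lemma integral_gamma_integrand_rate c r : 0 < c -> 0 < r ->
  (\int[mu]_(t in `]0%R, +oo[) (t `^ (c - 1) * expR (- (r * t)))%:E =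
   (r `^ (- c) * Gamma c)%:E)%E.
Proof.
move=> c0 r0.
have g0 t : (0 <= (gamma_integrand c t)%:E)%E.
  by rewrite lee_fin gamma_integrand_ge0.
have mg : measurable_fun (`]0, +oo[ : set R) (EFin \o gamma_integrand c).
  apply/measurable_EFinP; apply: measurable_funTS.
  exact: measurable_gamma_integrand.
transitivity (\int[mu]_(t in `]0%R, +oo[)
    ((r `^ (1 - c))%:E * (gamma_integrand c (r * t))%:E))%E.
  apply: eq_integral => t; rewrite inE/= in_itv/= andbT => t0.
  rewrite -EFinM /gamma_integrand powRM ?ltW// !mulrA.
  rewrite -powRD ?(gt_eqF r0) ?implybT//.
  by rewrite addrA subrK subrr powRr0 mul1r.
transitivity ((r `^ (1 - c))%:E *
    \int[mu]_(t in `]0%R, +oo[) (gamma_integrand c (r * t))%:E)%E.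
  apply: ge0_integralZl_EFin => //; last exact: powR_ge0.
  apply/measurable_EFinP; apply: measurable_funTS.
  apply: (measurableT_comp (measurable_gamma_integrand c)).
  exact: mulrl_measurable.
have := ge0_integral_itv0y_dilation r0 mg (fun t _ => g0 t).
rewrite /= Gamma_EFin// => GE.
rewrite EFinM GE muleA -EFinM; congr (_%:E * _)%E.
by rewrite addrC powRD ?(gt_eqF r0) ?implybT// powRr1// ltW.
Qed.

Lemma integrable_gamma_integrand_rate c r : 0 < c -> 0 < r ->
  mu.-integrable `]0, +oo[ (fun t => (t `^ (c - 1) * expR (- (r * t)))%:E).
Proof.
move=> c0 r0; apply/integrableP; split.
  apply/measurable_EFinP; apply: measurable_funTS; apply: measurable_funM.
    exact: measurable_powR.
  by do 2 apply: measurableT_comp => //; exact: measurable_funM.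
under eq_integral do rewrite /= ger0_norm ?mulr_ge0 ?powR_ge0 ?expR_ge0//.
by rewrite integral_gamma_integrand_rate// ltry.
Qed.

End gamma_integral.

(** * The derivative of Gamma *)

Section digamma_integral.
Context {R : realType}.
Local Notation mu := (@lebesgue_measure R).
Implicit Types (a c r s t x y : R).

(** With x = ln t, this bounds |ln t| t^(y-1) uniformly for y near a.  The
    factor |x| costs an exponent a/4, since z <= e^z at z = (a/4) |x|.  For
    x >= 0 the worst y is 3a/2, whence 3a/2 + a/4 = 7a/4; for x < 0 it is a/2,
    whence a/2 - a/4 = a/4. *)
Lemma normr_mul_expR_le a y x : 0 < a -> a / 2 < y < a * 3 / 2 ->
  `|x| * expR ((y - 1) * x) <=
  4 / a * (expR ((a / 4 - 1) * x) + expR ((a * 7 / 4 - 1) * x)).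
Proof.
move=> a0 /andP[ay ya].
have le_expR (z : R) : z <= expR z.
  by rewrite (le_trans _ (expR_ge1Dx z))// lerDr.
have K0 : 0 < 4 / a by rewrite divr_gt0.
have xE : `|x| = 4 / a * (a / 4 * `|x|) by field; rewrite gt_eqF.
rewrite {1}xE -(mulrA (4 / a)) ler_pM2l//.
apply: (@le_trans _ _ (expR (a / 4 * `|x| + (y - 1) * x))).
  by rewrite expRD ler_wpM2r ?expR_ge0.
have [x0|x0] := lerP 0 x.
  by rewrite (ger0_norm x0) -[leLHS]add0r lerD ?expR_ge0// ler_expR; nra.
by rewrite (ltr0_norm x0) -[leLHS]addr0 lerD ?expR_ge0// ler_expR; nra.
Qed.

Definition log_gamma_integrand c t : R := ln t * gamma_integrand c t.

Definition log_gamma_bound a t : R :=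
  4 / a * (gamma_integrand (a / 4) t + gamma_integrand (a * 7 / 4) t).

Lemma normr_log_gamma_integrand_le a y t : 0 < a -> a / 2 < y < a * 3 / 2 ->
  0 < t -> `|log_gamma_integrand y t| <= log_gamma_bound a t.
Proof.
move=> a0 ay t0; rewrite /log_gamma_bound /log_gamma_integrand /gamma_integrand.
rewrite -mulrDl normrM [X in _ * X]ger0_norm ?mulr_ge0 ?powR_ge0 ?expR_ge0//.
by rewrite !mulrA ler_wpM2r ?expR_ge0// !powR_expR_ln// normr_mul_expR_le.
Qed.

Lemma integrable_log_gamma_bound a : 0 < a ->
  mu.-integrable `]0, +oo[ (EFin \o log_gamma_bound a).
Proof.
move=> a0; rewrite /log_gamma_bound.
have ? : 0 < a / 4 by lra.
have ? : 0 < a * 7 / 4 by lra.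
under [X in integrable _ _ X]eq_fun do rewrite /= EFinM EFinD.
apply: integrableZl => //.
by apply: integrableD => //; exact: integrable_gamma_integrand.
Qed.

Lemma measurable_log_gamma_integrand c :
  measurable_fun setT (log_gamma_integrand c).
Proof.
apply: measurable_funM; first exact: measurable_ln.
exact: measurable_gamma_integrand.
Qed.

Lemma integrable_log_gamma_integrand a : 0 < a ->
  mu.-integrable `]0, +oo[ (EFin \o log_gamma_integrand a).
Proof.
move=> a0; apply: le_integrable (integrable_log_gamma_bound a0) => //.
  apply/measurable_EFinP; apply: measurable_funTS.
  exact: measurable_log_gamma_integrand.
move=> t /=; rewrite in_itv/= andbT => t0.
rewrite lee_fin (le_trans _ (ler_norm _))//.
by apply: normr_log_gamma_integrand_le => //; lra.
Qed.

Lemma is_derive_gamma_integrand t y : 0 < t ->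
  is_derive y 1 (gamma_integrand ^~ t) (log_gamma_integrand y t).
Proof.
move=> t0.
have -> : gamma_integrand ^~ t = (fun c => expR ((c - 1) * ln t) * expR (- t)).
  by apply/funext => c; rewrite /gamma_integrand powR_expR_ln.
apply: is_derive_eq.
rewrite /log_gamma_integrand /gamma_integrand powR_expR_ln//.
rewrite !scaler0 !add0r subr0 /GRing.scale/=; ring.
Qed.

Lemma is_derive_Gamma a : 0 < a ->
  is_derive a 1 (@Gamma R) (\int[mu]_(t in `]0, +oo[) log_gamma_integrand a t).
Proof.
move=> a0.
have Ia : `](a / 2), (a * 3 / 2)[%classic a by rewrite /= in_itv/=; lra.
have pos y : `](a / 2), (a * 3 / 2)[%classic y -> 0 < y.
  by rewrite /= in_itv/=; lra.
have intf y : `](a / 2), (a * 3 / 2)[%classic y ->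
    mu.-integrable `]0, +oo[ (EFin \o gamma_integrand y).
  by move=> /pos; exact: integrable_gamma_integrand.
have d1E y t : 0 < t ->
    partial1of2 gamma_integrand y t = log_gamma_integrand y t.
  by move=> t0; rewrite partial1of2E; have [] := is_derive_gamma_integrand y t0.
have derf y t : `](a / 2), (a * 3 / 2)[%classic y ->
    (`]0, +oo[%classic : set R) t ->
    derivable (gamma_integrand ^~ t) y 1.
  move=> _ /=; rewrite in_itv/= andbT => t0.
  by have [] := is_derive_gamma_integrand y t0.
have G0 t : 0 <= log_gamma_bound a t.
  by rewrite mulr_ge0 ?addr_ge0 ?gamma_integrand_ge0// divr_ge0// ltW.
have G_ub y t : `](a / 2), (a * 3 / 2)[%classic y ->
    (`]0, +oo[%classic : set R) t ->
    `|partial1of2 gamma_integrand y t| <= log_gamma_bound a t.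
  rewrite /= !in_itv/= andbT => ay t0; rewrite d1E//.
  exact: normr_log_gamma_integrand_le.
have -> : @Gamma R =
  fun x => \int[mu]_(t in `]0, +oo[) gamma_integrand x t by [].
have iG := integrable_log_gamma_bound a0.
apply: DeriveDef.
  by apply: (@derivable_under_integral _ _ _ mu gamma_integrand _ _ _ _ _ Ia
    intf derf _ G0 iG G_ub).
rewrite -derive1E (@differentiation_under_integral _ _ _ mu gamma_integrand
  _ _ _ _ _ Ia intf derf _ G0 iG G_ub)//.
by apply: eq_Rintegral => t; rewrite inE/= in_itv/= andbT; exact: d1E.
Qed.

(** The constant 1 / Gamma(a) is kept inside the integral so that Fubini's
    theorem, applied to it, yields the target integral without a factor. *)
Lemma digamma_EFin a : 0 < a ->
  (\int[mu]_(t in `]0%R, +oo[) ((Gamma a)^-1 * log_gamma_integrand a t)%:E =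
  (digamma a)%:E)%E.
Proof.
move=> a0; have G0 := Gamma_gt0 a0.
have ia := integrable_log_gamma_integrand a0.
under eq_integral do rewrite EFinM.
rewrite integralZl// -(@fineK _ (\int[_]_(_ in _) _))%E; last first.
  exact: integrable_fin_num.
rewrite -EFinM; congr EFin.
have ? := is_derive_Gamma a0; have ? := is_derive1_ln G0.
rewrite /digamma derive1E.
by have [_ ->] : is_derive a 1 (fun y => ln (Gamma y))
  ((Gamma a)^-1 * \int[mu]_(t in `]0, +oo[) log_gamma_integrand a t)
  by apply: is_derive_eq.
Qed.

End digamma_integral.

(** * The double integral *)

Section double_integral.
Context {R : realType}.
Local Notation mu := (@lebesgue_measure R).
Implicit Types (a c r s t x y : R).

Definition digamma_kernel a (z : R * R) : R :=
  (Gamma a)^-1 * gamma_integrand a z.1 * frullani_kernel z.1 z.2.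

Lemma measurable_digamma_kernel a :
  measurable_fun ((`]0, +oo[ : set R) `*` (`]0, +oo[ : set R))
    (EFin \o digamma_kernel a).
Proof.
apply/measurable_EFinP; apply: measurable_funM.
  apply: measurable_funM => //; apply: measurable_funTS.
  exact: (measurableT_comp (measurable_gamma_integrand a)).
apply: measurable_frullani_kernel; [exact: measurable_funTS..|].
by move=> [t s] [/= _]; rewrite in_itv/= andbT.
Qed.

Lemma integral_digamma_kernel2 a t : 0 < t ->
  (\int[mu]_(s in `]0%R, +oo[) (digamma_kernel a (t, s))%:E =
   ((Gamma a)^-1 * log_gamma_integrand a t)%:E)%E.
Proof.
move=> t0; under eq_integral do rewrite EFinM /=.
rewrite integralZl//; last exact: integrable_frullani.
rewrite integral_frullani// -EFinM; congr EFin.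
by rewrite /log_gamma_integrand /=; ring.
Qed.

Lemma integral_normr_digamma_kernel2 a t : 0 < t ->
  (\int[mu]_(s in `]0%R, +oo[) `|(digamma_kernel a (t, s))%:E| =
   `|((Gamma a)^-1 * log_gamma_integrand a t)%:E|)%E.
Proof.
move=> t0; under eq_integral do rewrite EFinM abseM /=.
rewrite integralZl//; last exact: (integrable_abse (integrable_frullani t0)).
rewrite integral_normr_frullani// -EFinM /=; congr EFin.
by rewrite -normrM; congr `|_|; rewrite /log_gamma_integrand /=; ring.
Qed.

Lemma integral_digamma_kernel1 a s : 0 < a -> 0 < s ->
  (\int[mu]_(t in `]0%R, +oo[) (digamma_kernel a (t, s))%:E =
   ((expR (- s) - (1 + s) `^ (- a)) / s)%:E)%E.
Proof.
move=> a0 s0; have G0 := Gamma_gt0 a0.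
have s10 : 0 < 1 + s by rewrite addr_gt0.
pose g t := t `^ (a - 1) * expR (- ((1 + s) * t)).
transitivity (\int[mu]_(t in `]0%R, +oo[)
    (((Gamma a * s)^-1)%:E *
      ((expR (- s))%:E * (gamma_integrand a t)%:E - (g t)%:E)))%E.
  apply: eq_integral => t _; rewrite -[RHS]/((Gamma a * s)^-1 *
    (expR (- s) * gamma_integrand a t - g t))%:E; congr EFin.
  rewrite /digamma_kernel /frullani_kernel /g /gamma_integrand /=.
  have -> : expR (- ((1 + s) * t)) = expR (- t) * expR (- (s * t)).
    by rewrite -expRD; congr expR; ring.
  by field; rewrite (gt_eqF s0) (gt_eqF G0).
have ig := integrable_gamma_integrand a0.
have ih := integrable_gamma_integrand_rate a0 s10.
have igs : mu.-integrable `]0, +oo[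
    (fun t => ((expR (- s))%:E * (gamma_integrand a t)%:E)%E).
  exact: integrableZl.
rewrite integralZl//; last exact: integrableB.
rewrite integralB// integralZl// Gamma_EFin// integral_gamma_integrand_rate//.
rewrite -[LHS]/((Gamma a * s)^-1 *
  (expR (- s) * Gamma a - (1 + s) `^ (- a) * Gamma a))%:E; congr EFin.
by field; rewrite (gt_eqF s0) (gt_eqF G0).
Qed.

End double_integral.

Theorem proposition2p1 (R : realType) (a : R) (ha : 0 < a) :
  (\int[@lebesgue_measure R]_(x in `]0%R, +oo[)
     ((expR (- x) - (1 + x) `^ (- a)) / x)%:E)%E = (digamma a)%:E.
Proof.
pose mu := @lebesgue_measure R.
have ilog : mu.-integrable `]0, +oo[
    (fun t => ((Gamma a)^-1 * log_gamma_integrand a t)%:E).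
  under [X in integrable _ _ X]eq_fun do rewrite EFinM.
  by apply: integrableZl => //; exact: integrable_log_gamma_integrand.
rewrite -digamma_EFin//.
transitivity (\int[mu]_(s in `]0%R, +oo[) \int[mu]_(t in `]0%R, +oo[)
    (digamma_kernel a (t, s))%:E)%E.
  apply: eq_integral => s; rewrite inE/= in_itv/= andbT => s0.
  by rewrite integral_digamma_kernel1.
transitivity (\int[mu]_(t in `]0%R, +oo[) \int[mu]_(s in `]0%R, +oo[)
    (digamma_kernel a (t, s))%:E)%E; last first.
  apply: eq_integral => t; rewrite inE/= in_itv/= andbT => t0.
  by rewrite integral_digamma_kernel2.
apply/esym.
apply: (@fubini_rect _ _ _ _ _ mu mu _ _ _ _ (EFin \o digamma_kernel a)) => //.
  exact: measurable_digamma_kernel.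
have /integrableP[_] := ilog; apply: le_lt_trans.
rewrite le_eqVlt; apply/orP; left; apply/eqP.
apply: eq_integral => t; rewrite inE/= in_itv/= andbT => t0.
exact: integral_normr_digamma_kernel2.
Qed.
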